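(* Let $X$ be a Banach space, let $A,B,C,D\in\mathcal L(X)$ and let $M=\begin{bmatrix}A&B\\ C&D\end{bmatrix}\in M_2(\mathcal L(X))$. Suppose that $A$ and $D$ have strongly Drazin inverses. If $BDD^D=0$, $D^{\pi}CB=0$ and $D^{\pi}CA=0$, then $M$ has Hirano inverse.
   Context: $\mathcal L(X)$ is the Banach algebra of all bounded linear operators on the Banach space $X$; $I$ is the identity operator. $M_2(\mathcal L(X))$ is the algebra of $2\times 2$ matrices over $\mathcal L(X)$ (bounded operators on $X\oplus X$). Let $\mathcal R$ be $\mathcal L(X)$ or $M_2(\mathcal L(X))$ and $T\in\mathcal R$. - $T$ has Drazin inverse if there is $Z\in\mathcal R$ with $TZ=ZT$, $Z=ZTZ$ and $T-T^2Z$ nilpotent; such $Z$ is unique if it exists and is denoted $T^D$. - $T$ has strongly Drazin inverse if there is $Z\in\mathcal R$ with $TZ=ZT$, $Z=ZTZ$ and $T-TZ$ nilpotent; such $Z$ is unique, and it is then also the Drazin inverse $T^D$. - $T$ has Hirano inverse if there is $Z\in\mathcal R$ with $TZ=ZT$, $Z=ZTZ$ and $T^2-TZ$ nilpotent. For $T$ with Drazin inverse, $T^{\pi}=I-TT^D$. *)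

(* Defs.v *)
From HB Require Import structures.
From mathcomp Require Import all_boot all_order all_algebra.
From mathcomp Require Import all_classical all_reals all_analysis.

Set Implicit Arguments.
Unset Strict Implicit.
Unset Printing Implicit Defensive.

Import Order.TTheory GRing.Theory Num.Theory.
Import numFieldNormedType.Exports.

Local Open Scope classical_set_scope.
Local Open Scope ring_scope.

Section BoundedOperators.
Variables (K : numFieldType) (X : normedModType K).

Definition bounded_linear (f : X -> X) : Prop :=
  linear f /\ exists M : K, forall x, `|f x| <= M * `|x|.

Definition bounded_linear_pred : {pred X -> X} :=
  [pred f | `[< bounded_linear f >]].

Lemma bounded_linear0 : bounded_linear 0.
Proof.
split; first by move=> a x y; rewrite -[LHS]/(0 : X) -[RHS]/(a *: (0 : X) + 0) scaler0 addr0.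
by exists 0 => x; rewrite -[X in `|X|]/(0 : X) normr0 mul0r.
Qed.

Lemma bounded_linearB (f g : X -> X) :
  bounded_linear f -> bounded_linear g -> bounded_linear (f - g).
Proof.
move=> [fL [M fM]] [gL [N gN]]; split.
  by move=> a x y; rewrite !fctE fL gL scalerBr addrACA opprD.
exists (M + N) => x; rewrite !fctE mulrDl.
by rewrite (le_trans (ler_normB _ _))// lerD.
Qed.

Lemma bounded_linear_id : bounded_linear id.
Proof. by split=> //; exists 1 => x; rewrite mul1r. Qed.

Lemma bounded_linear_comp (f g : X -> X) :
  bounded_linear f -> bounded_linear g -> bounded_linear (f \o g).
Proof.
move=> [fL [M fM]] [gL [N gN]]; split; first by move=> a x y /=; rewrite gL fL.
exists (`|M| * N) => x /=. (* M may be negative when X is the zero space *)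
have fM' y : `|f y| <= `|M| * `|y|.
  by rewrite -[leLHS]ger0_norm// -[in leRHS](normr_id y) -normrM
             ger0_norm// ger0_norm ?fM// (le_trans _ (fM y)).
by rewrite -mulrA (le_trans (fM' _))// ler_wpM2l.
Qed.

Lemma bounded_linear_zmod_closed : zmod_closed bounded_linear_pred.
Proof.
split; first exact: (asboolT bounded_linear0).
by move=> f g /asboolP fb /asboolP gb; apply/asboolP/bounded_linearB.
Qed.

HB.instance Definition _ :=
  GRing.isZmodClosed.Build (X -> X) bounded_linear_pred
    bounded_linear_zmod_closed.

Record boundedOp : Type := BoundedOp {
  boundedOp_fun :> X -> X;
  boundedOpP : boundedOp_fun \in bounded_linear_pred
}.

HB.instance Definition _ := [isSub for boundedOp_fun].
HB.instance Definition _ := [Choice of boundedOp by <:].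
HB.instance Definition _ := [SubChoice_isSubZmodule of boundedOp by <:].

Lemma boundedOp_bounded (f : boundedOp) : bounded_linear f.
Proof. by apply/asboolP; have := boundedOpP f; rewrite inE. Qed.

Definition boundedOp_one : boundedOp :=
  @BoundedOp id (asboolT bounded_linear_id).

Definition boundedOp_mul (f g : boundedOp) : boundedOp :=
  @BoundedOp (f \o g)
    (asboolT (bounded_linear_comp (boundedOp_bounded f) (boundedOp_bounded g))).

Lemma boundedOp_mulA : associative boundedOp_mul.
Proof. by move=> f g h; apply/val_inj. Qed.

Lemma boundedOp_mul1 : left_id boundedOp_one boundedOp_mul.
Proof. by move=> f; apply/val_inj. Qed.

Lemma boundedOp_mulr1 : right_id boundedOp_one boundedOp_mul.
Proof. by move=> f; apply/val_inj. Qed.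

Lemma boundedOp_mulDl : left_distributive boundedOp_mul +%R.
Proof. by move=> f g h; apply/val_inj. Qed.

Lemma boundedOp_mulDr : right_distributive boundedOp_mul +%R.
Proof.
move=> f g h; apply/val_inj/funext => x.
change (f (g x + h x) = f (g x) + f (h x)).
by rewrite -[g x]scale1r (boundedOp_bounded f).1 !scale1r.
Qed.

(* Composition makes the bounded operators a ring; it is a `pzRingType` only,
   since 1 = 0 when X is the zero space. *)
HB.instance Definition _ := GRing.Zmodule_isPzRing.Build boundedOp
  boundedOp_mulA boundedOp_mul1 boundedOp_mulr1 boundedOp_mulDl boundedOp_mulDr.

Lemma boundedOp_addE (f g : boundedOp) x : (f + g) x = f x + g x.
Proof. by []. Qed.

Lemma boundedOp_oppE (f : boundedOp) x : (- f) x = - f x.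
Proof. by []. Qed.

Lemma boundedOp_mulE (f g : boundedOp) x : (f * g) x = f (g x).
Proof. by []. Qed.

Lemma boundedOp_oneE x : (1 : boundedOp) x = x.
Proof. by []. Qed.

End BoundedOperators.

Section GeneralizedInverses.
Variable R : pzRingType.
Implicit Types T Z : R.

Definition nilpotent T : Prop := exists n : nat, T ^+ n = 0.

Definition is_drazin_inverse T Z : Prop :=
  [/\ T * Z = Z * T, Z = Z * T * Z & nilpotent (T - T ^+ 2 * Z)].

Definition is_strongly_drazin_inverse T Z : Prop :=
  [/\ T * Z = Z * T, Z = Z * T * Z & nilpotent (T - T * Z)].

Definition is_hirano_inverse T Z : Prop :=
  [/\ T * Z = Z * T, Z = Z * T * Z & nilpotent (T ^+ 2 - T * Z)].

Definition has_drazin_inverse T : Prop := exists Z, is_drazin_inverse T Z.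

Definition has_strongly_drazin_inverse T : Prop :=
  exists Z, is_strongly_drazin_inverse T Z.

Definition has_hirano_inverse T : Prop := exists Z, is_hirano_inverse T Z.

(* Junk value 0 when T has no Drazin inverse; see drazin_invP, drazin_invE. *)
Definition drazin_inv T : R := xget 0 [set Z | is_drazin_inverse T Z].

Definition drazin_pi T : R := 1 - T * drazin_inv T.

Lemma drazin_inverse_expr T Z : T * Z = Z * T -> Z = Z * T * Z ->
  forall n, (T - T ^+ 2 * Z) ^+ n.+1 = T ^+ n.+1 * (1 - T * Z).
Proof.
move=> TZ ZTZ n.
have eI : (T * Z) * (T * Z) = T * Z by rewrite -mulrA [Z * (T * Z)]mulrA -ZTZ.
have eI' : (1 - T * Z) * (1 - T * Z) = 1 - T * Z.
  by rewrite mulrBr mulr1 mulrBl mul1r eI subrr subr0.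
have -> : T - T ^+ 2 * Z = T * (1 - T * Z) by rewrite mulrBr mulr1 mulrA -expr2.
rewrite exprMn_comm; last first.
  by apply: commrB; [exact: commr1 | apply: commrM => //; exact: commr_refl].
congr (_ * _); elim: n => [|n IHn]; first by rewrite expr1.
by rewrite exprS IHn.
Qed.

Lemma drazin_inverse_absorb T Z Z' :
  is_drazin_inverse T Z -> is_drazin_inverse T Z' ->
  T * Z' * (T * Z) = T * Z' /\ T * Z * (T * Z') = T * Z'.
Proof.
move=> [TZ ZTZ [n nil]] [TZ' ZTZ' _].
have fI : (T * Z') * (T * Z') = T * Z'.
  by rewrite -mulrA [Z' * (T * Z')]mulrA -ZTZ'.
have fX : T * Z' = T ^+ n.+1 * Z' ^+ n.+1.
  rewrite -exprMn_comm//.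
  elim: n {nil} => [|n IHn]; first by rewrite expr1.
  by rewrite exprS -IHn fI.
have nil' : T ^+ n.+1 * (1 - T * Z) = 0.
  by rewrite -drazin_inverse_expr// exprS nil mulr0.
have eT : (1 - T * Z) * T ^+ n.+1 = T ^+ n.+1 * (1 - T * Z).
  have cT : GRing.comm T (1 - T * Z).
    by apply: commrB; [exact: commr1 | apply: commrM => //; exact: commr_refl].
  exact/commrX/commr_sym.
split; apply/esym/eqP; rewrite -subr_eq0.
  rewrite -[X in X - _]mulr1 -mulrBr fX.
  have -> : T ^+ n.+1 * Z' ^+ n.+1 = Z' ^+ n.+1 * T ^+ n.+1.
    by apply: commrX; apply/commr_sym/commrX.
  by rewrite -mulrA nil' mulr0.
by rewrite -[X in X - _]mul1r -mulrBl fX mulrA eT nil' mul0r.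
Qed.

Lemma drazin_inverse_uniq T Z Z' :
  is_drazin_inverse T Z -> is_drazin_inverse T Z' -> Z = Z'.
Proof.
move=> dZ dZ'.
have [_ efE] := drazin_inverse_absorb dZ dZ'.
have [ef _] := drazin_inverse_absorb dZ' dZ.
have [fe _] := drazin_inverse_absorb dZ dZ'.
have [TZ ZTZ _] := dZ; have [TZ' ZTZ' _] := dZ'.
have e_f : T * Z = T * Z' by rewrite -ef efE.
by rewrite ZTZ -mulrA e_f mulrA -TZ e_f TZ' -ZTZ'.
Qed.

Lemma drazin_invP T : has_drazin_inverse T -> is_drazin_inverse T (drazin_inv T).
Proof. by rewrite /drazin_inv => -[Z dZ]; case: xgetP => [? _ //|/(_ Z)]. Qed.

Lemma drazin_invE T Z : is_drazin_inverse T Z -> drazin_inv T = Z.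
Proof.
by move=> dZ; apply: drazin_inverse_uniq (dZ); apply: drazin_invP; exists Z.
Qed.

Lemma strongly_drazin_inverseW T Z :
  is_strongly_drazin_inverse T Z -> is_drazin_inverse T Z.
Proof.
move=> [TZ ZTZ [n nil]]; split=> //; exists n.
have eI : (T * Z) * (T * Z) = T * Z by rewrite -mulrA [Z * (T * Z)]mulrA -ZTZ.
have -> : T - T ^+ 2 * Z = (T - T * Z) * (1 - T * Z).
  by rewrite mulrBr mulr1 mulrBl eI opprB addrA subrK mulrA -expr2.
rewrite exprMn_comm ?nil ?mul0r//.
have comm_e : GRing.comm T (T * Z) by apply: commrM.
apply: commrB; first exact: commr1.
by apply/commr_sym/commrB; [exact/commr_sym | exact: commr_refl].
Qed.

End GeneralizedInverses.

Section OperatorMatrix.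
Variable R : pzRingType.

Definition op_matrix (A B C D : R) : 'M[R]_2 :=
  block_mx A%:M B%:M C%:M D%:M : 'M[R]_(1 + 1).

Lemma op_matrixE (A B C D : R) :
  [/\ op_matrix A B C D 0 0 = A, op_matrix A B C D 0 1 = B,
      op_matrix A B C D 1 0 = C & op_matrix A B C D 1 1 = D].
Proof.
have i0 : 0 = lshift 1 0 :> 'I_(1 + 1) by apply/val_inj.
have i1 : 1 = rshift 1 0 :> 'I_(1 + 1) by apply/val_inj.
have sE (a : R) : (a%:M : 'M[R]_1) 0 0 = a by rewrite mxE mulr1n.
split; rewrite /op_matrix ?i0 ?i1.
- exact: etrans (block_mxEul _ _ _ _ _ _) (sE A).
- exact: etrans (block_mxEur _ _ _ _ _ _) (sE B).
- exact: etrans (block_mxEdl _ _ _ _ _ _) (sE C).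
- exact: etrans (block_mxEdr _ _ _ _ _ _) (sE D).
Qed.

End OperatorMatrix.

(* Main.v *)
Require Import Defs.
From mathcomp Require Import all_boot all_order all_algebra.
From mathcomp Require Import all_classical all_reals all_analysis.
Import GRing.Theory.
Local Open Scope ring_scope.

(** The statement is purely algebraic and holds over every ring.  In any ring,
    [T] has a strongly Drazin inverse exactly when [T - T ^+ 2] is nilpotent
    ([nilpotent_subX2_of_strongly_drazin], [strongly_drazin_of_nilpotent_subX2]),
    and a strongly Drazin inverse is also a Hirano inverse
    ([hirano_of_strongly_drazin]).  So it is enough that the property
    ``[T - T ^+ 2] is nilpotent'' passes from [A] and [D] to [M].

    This property is stable under sums [a + b] with [b * a = 0]
    ([nilpotent_subX2D]).  Writing [e = D D^D] and [p = 1 - e], decompose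
    [[
      M = [[A, B], [0, 0]] + [[0, 0], [p C, p D]] + [[0, 0], [e C, e D]].
    ]]
    The hypotheses [p C A = p C B = 0] say that the second summand times the
    first vanishes.  The first two summands times the third vanish because
    [B e = 0] and [p D e = p e D = 0].  Each summand is in turn the sum of a
    diagonal and a square-zero matrix whose product in one order vanishes, and
    the diagonal entries [A], [p D], [e D] have the property: [p D] is
    nilpotent, and [e D - (e D) ^+ 2 = e (D - D ^+ 2)]. *)

(** * Nilpotent elements and strongly Drazin inverses *)

Section NilpotentDefect.
Set Implicit Arguments.
Unset Strict Implicit.
Variable R : pzRingType.
Implicit Types x y a b e T Z : R.

Lemma nilpotentM x y : GRing.comm x y -> nilpotent x -> nilpotent (x * y).
Proof. by move=> cxy [n xn]; exists n; rewrite exprMn_comm// xn mul0r. Qed.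

Lemma nilpotent0 : nilpotent (0 : R).
Proof. by exists 1%N; rewrite expr1. Qed.

Lemma comm_subX2 x y : GRing.comm x y -> GRing.comm (x - x ^+ 2) y.
Proof.
by move=> cxy; apply/commr_sym/commrB; [|apply: commrX]; apply/commr_sym.
Qed.

Lemma nilpotent_subX2 x : nilpotent x -> nilpotent (x - x ^+ 2).
Proof.
move=> nx; rewrite expr2 -{1}[x]mulr1 -mulrBr; apply: nilpotentM nx.
exact: commrB (commr1 _) (commr_refl _).
Qed.

Lemma nilpotent_subX2_square0 x : x * x = 0 -> nilpotent (x - x ^+ 2).
Proof. by move=> xx0; apply: nilpotent_subX2; exists 2%N; rewrite expr2. Qed.

(** Let [N = a + b] and [q n = (N - N ^+ 2) ^+ n].  As [N a = a ^+ 2] and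
    [b N = b ^+ 2], left multiplication of [a] by a polynomial in [N] is
    multiplication by the same polynomial in [a], and likewise for [b] on the
    other side.  Hence [q k * a] and [b * q m] vanish for suitable exponents,
    so that [q k * N * q m = q k * a * q m + q k * b * q m = 0].  As [N] divides
    [N - N ^+ 2], this gives [q (k + m + 1) = 0]. *)
Lemma nilpotent_subX2D a b : b * a = 0 ->
  nilpotent (a - a ^+ 2) -> nilpotent (b - b ^+ 2) ->
  nilpotent ((a + b) - (a + b) ^+ 2).
Proof.
move=> ba0 [k ak] [m bm].
have [N NE] : exists N, N = a + b by exists (a + b).
have [q qE] : exists q, q = N - N ^+ 2 by exists (N - N ^+ 2).
rewrite -NE -qE.
have Na : N * a = a * a by rewrite NE mulrDl ba0 addr0.
have bN : b * N = b * b by rewrite NE mulrDr ba0 add0r.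
have qa n : q ^+ n * a = a * (a - a ^+ 2) ^+ n.
  elim: n => [|n IHn]; first by rewrite !expr0 mulr1 mul1r.
  have qa1 : q * a = a * (a - a ^+ 2).
    by rewrite qE mulrBl mulrBr !expr2 -!mulrA Na [N * _]mulrA Na -mulrA.
  by rewrite exprSr -mulrA qa1 mulrA IHn -mulrA -exprSr.
have bq n : b * q ^+ n = (b - b ^+ 2) ^+ n * b.
  elim: n => [|n IHn]; first by rewrite !expr0 mulr1 mul1r.
  have bq1 : b * q = (b - b ^+ 2) * b.
    by rewrite qE mulrBl mulrBr !expr2 mulrA bN -!mulrA bN.
  by rewrite exprS mulrA bq1 -mulrA IHn mulrA -exprS.
have qNq : q ^+ k * N * q ^+ m = 0.
  by rewrite {1}NE mulrDr mulrDl qa ak mulr0 mul0r add0r -mulrA bq bm mul0r mulr0.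
have cNq : GRing.comm (1 - N) (q ^+ m).
  apply/commrX; rewrite qE; apply/commr_sym/comm_subX2.
  exact: commrB (commr1 _) (commr_refl _).
have qN : q = N * (1 - N) by rewrite mulrBr mulr1 -expr2.
exists (k + m.+1)%N.
by rewrite exprD exprS {2}qN -!mulrA cNq !mulrA qNq mul0r.
Qed.

Section StronglyDrazinInverse.
Variables (T Z : R).
Hypothesis sZ : is_strongly_drazin_inverse T Z.

Lemma strongly_drazin_comm : GRing.comm T (T * Z).
Proof. by case: sZ => cTZ _ _; apply: commrM. Qed.

Lemma strongly_drazin_idem : (T * Z) * (T * Z) = T * Z.
Proof. by case: sZ => _ ZTZ _; rewrite -mulrA [Z * (T * Z)]mulrA -ZTZ. Qed.

(** With [e = T Z] idempotent, [T - T ^+ 2 = (T - e) (1 - T - e)] is a multiple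
    of the nilpotent [T - e] by an element commuting with it. *)
Lemma nilpotent_subX2_of_strongly_drazin : nilpotent (T - T ^+ 2).
Proof.
have ce := strongly_drazin_comm; have eI := strongly_drazin_idem.
case: sZ => _ _; set e := T * Z in ce eI *.
have -> : T - T ^+ 2 = (T - e) * (1 - T - e).
  rewrite mulrBl !mulrBr !mulr1 eI ce -expr2.
  by rewrite [e - _ - e]addrAC subrr add0r opprK subrK.
apply: nilpotentM.
have cT1e : GRing.comm T (1 - T - e).
  exact: commrB (commrB (commr1 _) (commr_refl _)) ce.
have ce1e : GRing.comm e (1 - T - e).
  exact: commrB (commrB (commr1 _) (commr_sym ce)) (commr_refl _).
by apply/commr_sym/commrB; apply/commr_sym.
Qed.

(** Again a multiple of [T - e], since [T ^+ 2 - e = (T - e) (T + e)]. *)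
Lemma hirano_of_strongly_drazin : is_hirano_inverse T Z.
Proof.
have ce := strongly_drazin_comm; have eI := strongly_drazin_idem.
case: sZ => cTZ ZTZ nT; split=> //; set e := T * Z in ce eI nT *.
have -> : T ^+ 2 - e = (T - e) * (T + e).
  by rewrite mulrBl !mulrDr eI ce -expr2 opprD addrA addrK.
apply: nilpotentM nT.
apply: commrD; apply/commr_sym/commrB => //; exact/commr_sym.
Qed.

(** Multiplying by [1 - T Z] cannot distinguish [T] from [T - T Z], because
    [T Z] is idempotent. *)
Lemma nilpotent_pi_strongly_drazin : nilpotent ((1 - T * Z) * T).
Proof.
have ce := strongly_drazin_comm; have eI := strongly_drazin_idem.
case: sZ => _ _; set e := T * Z in ce eI *.
have -> : (1 - e) * T = (T - e) * (1 - e).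
  by rewrite [LHS]mulrBl mul1r mulrBr mulr1 [_ * e]mulrBl eI opprB addrA subrK ce.
apply: nilpotentM; apply: commrB; first exact: commr1.
by apply/commr_sym/commrB; [exact/commr_sym | exact: commr_refl].
Qed.

End StronglyDrazinInverse.

Lemma comm_mul_subX2 x y : GRing.comm x y -> x * x = x ->
  nilpotent (y - y ^+ 2) -> nilpotent (x * y - (x * y) ^+ 2).
Proof.
move=> cxy xI ny; rewrite exprMn_comm// expr2 xI -mulrBr.
have cx : GRing.comm (y - y ^+ 2) x by exact/comm_subX2/commr_sym.
by rewrite -cx; apply: nilpotentM.
Qed.

(** The quotient is a geometric sum in [1 - x]; being a polynomial in [x], it
    commutes with whatever commutes with [x]. *)
Lemma sub1_expr_factor x n : exists2 g,
  1 - (1 - x) ^+ n = x * g & forall y, GRing.comm y x -> GRing.comm y g.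
Proof.
elim: n => [|n [g gE cg]].
  by exists 0 => [|y _]; [rewrite expr0 subrr mulr0 | exact: commr0].
exists (g + (1 - x) ^+ n) => [|y cyx].
  by rewrite mulrDr -gE exprS mulrBl mul1r opprB [x * _ - _]addrC addrA.
apply: commrD; first exact: cg.
by apply/commrX/commrB; [exact: commr1 |].
Qed.

(** From [T ^+ n (1 - T) ^+ n = 0] one lifts the idempotent [T] modulo the
    nilpotent element [T - T ^+ 2]: the element [e = (1 - (1 - T) ^+ n) ^+ n] is
    divisible by [T ^+ n] and [1 - e] by [(1 - T) ^+ n], so [e] is idempotent
    and [T - e = T (1 - e) - (1 - T) e] is a multiple of [T (1 - T)].  If
    [e = T v], then [Z = v e] satisfies [T Z = e], hence is the inverse. *)
Lemma strongly_drazin_of_nilpotent_subX2 T :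
  nilpotent (T - T ^+ 2) -> has_strongly_drazin_inverse T.
Proof.
case=> n Tn.
(* The exponent is raised to [n.+1] so that [e] has a factor [T] to divide by,
   even when the given exponent is 0. *)
have {}Tn : (T * (1 - T)) ^+ n.+1 = 0.
  by rewrite mulrBr mulr1 -expr2 exprSr Tn mul0r.
have cT1 : GRing.comm T (1 - T) by exact: commrB (commr1 _) (commr_refl _).
have [g gE cg] := sub1_expr_factor T n.+1.
have [s sE cs] := sub1_expr_factor ((1 - T) ^+ n.+1) n.+1.
have {}cg : GRing.comm T g by exact: cg.
have {}cs : GRing.comm T s by apply: cs; apply: commrX.
have [e eE] : exists e, e = (T * g) ^+ n.+1 by exists ((T * g) ^+ n.+1).
rewrite gE -eE in sE.
have [v vE] : exists v, v = T ^+ n * g ^+ n.+1 by exists (T ^+ n * g ^+ n.+1).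
have cv : GRing.comm T v.
  by rewrite vE; apply: commrM; apply: commrX => //; exact: commr_refl.
have eTv : e = T * v by rewrite eE vE exprMn_comm// exprS mulrA.
have ce : GRing.comm T e by rewrite eTv; apply: commrM.
have cgT : GRing.comm (g ^+ n.+1) ((1 - T) ^+ n.+1).
  apply/commrX/commr_sym/commrX/commr_sym/commrB; first exact: commr1.
  exact/commr_sym.
have e1e : e * (1 - e) = 0.
  rewrite sE eE exprMn_comm// -mulrA [g ^+ _ * _]mulrA cgT !mulrA.
  by rewrite -exprMn_comm// Tn !mul0r.
have ee : e * e = e.
  by apply/esym/eqP; rewrite -subr_eq0 -{1}[e]mulr1 -mulrBr e1e.
have cve : GRing.comm v e by rewrite eTv; apply: commrM => //; exact/commr_sym.
exists (v * e).
have TZ : T * (v * e) = e by rewrite mulrA -eTv ee.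
split.
- by rewrite TZ -mulrA -ce mulrA -cv -eTv ee.
- by rewrite -[RHS]mulrA TZ -mulrA ee.
rewrite TZ.
have -> : T - e = (T - T ^+ 2) * ((1 - T) ^+ n * s - v).
  rewrite [RHS]mulrBr; have -> : T - T ^+ 2 = T * (1 - T).
    by rewrite mulrBr mulr1 -expr2.
  rewrite -[T * _ * (_ * s)]mulrA [(1 - T) * (_ * s)]mulrA -exprS -sE.
  rewrite cT1 -mulrA -eTv mulrBr mulrBl mulr1 mul1r opprB.
  by rewrite addrA subrK.
apply: nilpotentM; last by exists n.+1; rewrite -Tn mulrBr mulr1 -expr2.
apply: comm_subX2; apply: commrB => //; apply: commrM => //.
exact: commrX.
Qed.

End NilpotentDefect.

(** * Matrices with two rows and columns *)

Section OperatorMatrixDefect.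
Set Implicit Arguments.
Unset Strict Implicit.
Variable R : pzRingType.
Implicit Types A B C D : R.

Lemma op_matrixD A B C D A' B' C' D' :
  op_matrix A B C D + op_matrix A' B' C' D' =
  op_matrix (A + A') (B + B') (C + C') (D + D').
Proof.
have := @add_block_mx R 1 1 1 1 A%:M B%:M C%:M D%:M
  A'%:M B'%:M C'%:M D'%:M.
by rewrite -!raddfD.
Qed.

Lemma op_matrixM A B C D A' B' C' D' :
  op_matrix A B C D * op_matrix A' B' C' D' =
  op_matrix (A * A' + B * C') (A * B' + B * D')
            (C * A' + D * C') (C * B' + D * D').
Proof.
have := @mulmx_block R 1 1 1 1 1 1 A%:M B%:M C%:M D%:M
  A'%:M B'%:M C'%:M D'%:M.
by rewrite -!scalar_mxM -!raddfD.
Qed.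

Lemma op_matrix0 : op_matrix 0 0 0 0 = 0 :> 'M[R]_2.
Proof. by rewrite /op_matrix !raddf0 block_mx0. Qed.

Lemma op_matrix_diagX A D n :
  op_matrix A 0 0 D ^+ n = op_matrix (A ^+ n) 0 0 (D ^+ n).
Proof.
elim: n => [|n IHn]; first by rewrite !expr0 /op_matrix !raddf0 -scalar_mx_block.
by rewrite !exprS IHn op_matrixM !(mulr0, mul0r, addr0, add0r).
Qed.

Lemma nilpotent_diag A D :
  nilpotent A -> nilpotent D -> nilpotent (op_matrix A 0 0 D).
Proof.
move=> [m Am] [n Dn]; exists (m + n)%N.
by rewrite op_matrix_diagX !exprD Am Dn mul0r mulr0 op_matrix0.
Qed.

Lemma nilpotent_subX2_diag A D :
  nilpotent (A - A ^+ 2) -> nilpotent (D - D ^+ 2) ->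
  nilpotent (op_matrix A 0 0 D - op_matrix A 0 0 D ^+ 2).
Proof.
move=> nA nD; have -> : op_matrix A 0 0 D - op_matrix A 0 0 D ^+ 2 =
    op_matrix (A - A ^+ 2) 0 0 (D - D ^+ 2).
  by apply/eqP; rewrite subr_eq op_matrix_diagX op_matrixD !subrK !addr0.
exact: nilpotent_diag.
Qed.

Lemma nilpotent_subX2_top A B :
  nilpotent (A - A ^+ 2) ->
  nilpotent (op_matrix A B 0 0 - op_matrix A B 0 0 ^+ 2).
Proof.
move=> nA.
have -> : op_matrix A B 0 0 = op_matrix A 0 0 0 + op_matrix 0 B 0 0.
  by rewrite op_matrixD !(addr0, add0r).
apply: nilpotent_subX2D.
- by rewrite op_matrixM !(mulr0, mul0r, addr0) op_matrix0.
- by apply: nilpotent_subX2_diag => //; apply/nilpotent_subX2/nilpotent0.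
- apply: nilpotent_subX2_square0.
  by rewrite op_matrixM !(mulr0, mul0r, addr0) op_matrix0.
Qed.

Lemma nilpotent_subX2_bottom C D :
  nilpotent (D - D ^+ 2) ->
  nilpotent (op_matrix 0 0 C D - op_matrix 0 0 C D ^+ 2).
Proof.
move=> nD.
have -> : op_matrix 0 0 C D = op_matrix 0 0 0 D + op_matrix 0 0 C 0.
  by rewrite op_matrixD !(addr0, add0r).
apply: nilpotent_subX2D.
- by rewrite op_matrixM !(mulr0, mul0r, addr0) op_matrix0.
- by apply: nilpotent_subX2_diag => //; apply/nilpotent_subX2/nilpotent0.
- apply: nilpotent_subX2_square0.
  by rewrite op_matrixM !(mulr0, mul0r, addr0) op_matrix0.
Qed.

(** The summands [a], [b] of [nilpotent_subX2D] must be taken with [b * a = 0]: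
    the rows [e C, e D] come first as [a], and then the top rows [A, B] before
    the rows [(1 - e) C, (1 - e) D]. *)
Lemma strongly_drazin_op_matrix A B C D Z :
  has_strongly_drazin_inverse A -> is_strongly_drazin_inverse D Z ->
  B * (D * Z) = 0 -> (1 - D * Z) * C * B = 0 -> (1 - D * Z) * C * A = 0 ->
  has_strongly_drazin_inverse (op_matrix A B C D).
Proof.
move=> [Z' sA] sD; have ce := strongly_drazin_comm sD.
have eI := strongly_drazin_idem sD.
have npD := nilpotent_pi_strongly_drazin sD.
have nD := nilpotent_subX2_of_strongly_drazin sD.
have nA := nilpotent_subX2_of_strongly_drazin sA.
move: (D * Z) ce eI npD => e ce eI npD Be pCB pCA.
have pDe : (1 - e) * D * e = 0.
  by rewrite -mulrA ce mulrA mulrBl mul1r eI subrr mul0r.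
have -> : op_matrix A B C D =
    op_matrix 0 0 (e * C) (e * D) +
      (op_matrix A B 0 0 + op_matrix 0 0 ((1 - e) * C) ((1 - e) * D)).
  by rewrite [RHS]addrC !op_matrixD !mulrBl !mul1r !add0r !addr0 !subrK.
apply: strongly_drazin_of_nilpotent_subX2; apply: nilpotent_subX2D.
- rewrite op_matrixD op_matrixM !(mulr0, addr0, add0r) !mulrA.
  by rewrite pDe Be !mul0r op_matrix0.
- by apply/nilpotent_subX2_bottom/comm_mul_subX2 => //; exact/commr_sym.
- apply: nilpotent_subX2D.
  + by rewrite op_matrixM !(mulr0, mul0r, addr0, add0r) pCA pCB op_matrix0.
  + exact: nilpotent_subX2_top.
  + exact/nilpotent_subX2_bottom/nilpotent_subX2.
Qed.

End OperatorMatrixDefect.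

Theorem theorem2p7 (K : numFieldType) (X : completeNormedModType K)
    (A B C D : boundedOp X)
    (hA : has_strongly_drazin_inverse A)
    (hD : has_strongly_drazin_inverse D)
    (hBD : B * D * drazin_inv D = 0)
    (hCB : drazin_pi D * C * B = 0)
    (hCA : drazin_pi D * C * A = 0) :
  has_hirano_inverse (op_matrix A B C D).
Proof.
case: hD => Z sD; move: hBD hCB hCA.
rewrite /drazin_pi (drazin_invE (strongly_drazin_inverseW sD)) -mulrA.
move=> hBD hCB hCA.
have [W sW] : has_strongly_drazin_inverse (op_matrix A B C D).
  exact: strongly_drazin_op_matrix hA sD hBD hCB hCA.
by exists W; apply: hirano_of_strongly_drazin.
Qed.
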